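(* Every element of $\mathcal E_5(L)$ respects arbitrary, in particular heterogeneous, local thermodynamic equilibria: if $\widetilde{\Delta T}^{a\beta}=\Delta T_L^{a\beta}+\tilde\Delta T^{a\beta}\in\mathcal E_5(L)$, then $\widetilde{\Delta T}^{a\beta}=0$ for all $a,\beta$ at every state in $\mathcal D$ and every gradient $(\partial\psi_c/\partial x^\delta)$ such that $$\frac{\partial\psi_\gamma}{\partial x^\delta}\ \text{ is antisymmetric in }\gamma,\delta\in\{0,1,2,3\}\quad\text{and}\quad\frac{\partial\psi_4}{\partial x^\delta}=0 .$$
   Context: Setting: Minkowski space $\mathbb R^4$ with coordinates $x^\beta$, metric $g_{\alpha\beta}$ of signature $(-,+,+,+)$, summation convention. Greek indices run over $0,1,2,3$; indices $a,c,f,\tilde a$ run over $0,\dots,4$; Greek-range indices are raised and lowered with $g$, while for the index $4$ upper and lower positions are identified. Fluid: $U^\alpha$ is the future-directed 4-velocity, $U^\alpha U_\alpha=-1$, $\Pi^{\alpha\beta}=g^{\alpha\beta}+U^\alpha U^\beta$. The state variables (Godunov variables) are $\psi_\alpha=U_\alpha/\theta$ ($\theta>0$ temperature) and $\psi_4=g/\theta$ (chemical potential divided by temperature), ranging over the open set $\mathcal D$ of states for which $(\psi^\alpha)$ is future-directed timelike and $(\theta,\psi_4)$ lies in the domain of the equation of state $p=p(\theta,\psi_4)$, a smooth function with $p_\theta>0$, $p_{\psi_4}>0$. One has $\rho=\theta p_\theta-p$, $n=p_{\psi_4}/\theta$, $h=(\rho+p)/n$. The ideal tensor is $T^{\alpha\beta}=(\rho+p)U^\alpha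 U^\beta+p g^{\alpha\beta}$ for $\alpha\le 3$ and $T^{4\beta}=N^\beta=nU^\beta$; equivalently $T^{a\beta}=\partial(p\,\psi^\beta)/\partial\psi_a$. Landau-Lifshitz dissipation tensor: with smooth functions $\eta,\zeta,\kappa>0$ of the state, $$-\Delta T_L^{\alpha\beta}=\eta\,\Pi^{\alpha\gamma}\Pi^{\beta\delta}\Big(\frac{\partial U_\gamma}{\partial x^\delta}+\frac{\partial U_\delta}{\partial x^\gamma}-\frac23 g_{\gamma\delta}\frac{\partial U^\sigma}{\partial x^\sigma}\Big)+\zeta\,\Pi^{\alpha\beta}\frac{\partial U^\gamma}{\partial x^\gamma},\qquad -\Delta T_L^{4\beta}=\frac{\kappa}{h^2}\Pi^{\beta\delta}\frac{\partial\psi_4}{\partial x^\delta},$$ where gradients of $U$ are expressed linearly through the gradients of $\psi$ by the chain rule. Family $\mathcal E_5(L)$: for smooth functions $\lambda,\mu,\nu$ of the state let $C^\alpha_{\tilde\alpha}=\frac{\mu}{\theta^2}U^\alpha U_{\tilde\alpha}+\frac{\nu}{\theta}\Pi^\alpha_{\tilde\alpha}$ for $\alpha,\tilde\alpha\le3$, $C^4_4=\lambda$, $C^\alpha_4=C^4_\alpha=0$, and $$\tilde\Delta T^{a\beta}=\frac{\partial T^{a\beta}}{\partial\psi_f}\,C_{f\tilde a}\,\frac{\partial T^{\tilde a\delta}}{\partial\psi_c}\frac{\partial\psi_c}{\partial x^\delta},$$ where $C_{f\tilde a}$ is $C^f_{\tilde a}$ with first index lowered. $\mathcal E_5(L)$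 is the set of all $\Delta T_L^{a\beta}+\tilde\Delta T^{a\beta}$ obtained in this way (the orbit of $\Delta T_L$ under Eulerian gradient shifts). Local thermodynamic equilibria are characterized by the displayed condition on the gradient; a dissipation tensor ''respects'' them if it vanishes on all such gradients. *)

(* Defs.v *)
From mathcomp Require Import all_boot all_order all_algebra.
From mathcomp Require Import all_classical all_reals all_analysis.

Set Implicit Arguments.
Unset Strict Implicit.
Unset Printing Implicit Defensive.

Import Order.TTheory GRing.Theory Num.Theory.
Import numFieldNormedType.Exports.

Local Open Scope classical_set_scope.
Local Open Scope ring_scope.

(* On a finite-dimensional V and an open D, [Ck k D f] is the usual C^k
   regularity of f on D. *)
Fixpoint Ck (R : realType) (V : normedModType R) (k : nat) (D : set V)
    (f : V -> R^o) {struct k} : Prop :=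
  match k with
  | 0 => forall x, D x -> {for x, continuous f}
  | k'.+1 => (forall x, D x -> differentiable f x) /\
             (forall v : V, Ck k' D (fun x => 'D_v f x))
  end.

Definition smooth_on (R : realType) (V : normedModType R) (D : set V)
    (f : V -> R^o) : Prop := forall k, Ck k D f.

(* A state is the row of its lower components psi_0, ..., psi_4. *)
Notation state R := 'rV[R]_5 (only parsing).
(* Entry (c, delta) of a gradient is d psi_c / d x^delta. *)
Notation gradient R := 'M[R]_(5, 4) (only parsing).
(* Entry (a, beta) is the component T^{a beta}, both indices up. *)
Notation tensor R := 'M[R]_(5, 4) (only parsing).

(* Greek indices 0..3 are embedded in 0..4 with the same value; the
   remaining index 4 is [i4].  [unlift i4 a] is [Some alpha] for a Greek a,
   and [None] for a = 4. *)
Definition i4 : 'I_5 := ord_max.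
Definition greek (alpha : 'I_4) : 'I_5 := lift i4 alpha.

Section Minkowski.
Variable R : realType.
Implicit Types psi : state R.

(* diag(-1,1,1,1) is its own inverse: [metric] is both g_{alpha beta} and
   g^{alpha beta}. *)
Definition metric : 'M[R]_4 :=
  \matrix_(i, j) (if i == j then (if i == ord0 then -1 else 1) else 0).

Definition psi_low psi (alpha : 'I_4) : R := psi ord0 (greek alpha).
Definition psi_up psi (alpha : 'I_4) : R :=
  \sum_(beta < 4) metric alpha beta * psi_low psi beta.

Definition psi_sq psi : R := \sum_(alpha < 4) psi_up psi alpha * psi_low psi alpha.

Definition future_timelike psi : Prop := psi_sq psi < 0 /\ 0 < psi_up psi ord0.

(* theta is determined by psi_alpha = U_alpha / theta, U^alpha U_alpha = -1
   and theta > 0. *)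
Definition theta psi : R := (Num.sqrt (- psi_sq psi))^-1.
Definition psi4 psi : R := psi ord0 i4.

Definition U_low psi (alpha : 'I_4) : R := theta psi * psi_low psi alpha.
Definition U_up psi (alpha : 'I_4) : R := theta psi * psi_up psi alpha.

Definition Pi_up psi (alpha beta : 'I_4) : R :=
  metric alpha beta + U_up psi alpha * U_up psi beta.
(* Pi^alpha_beta *)
Definition Pi_mixed psi (alpha beta : 'I_4) : R :=
  \sum_(gamma < 4) Pi_up psi alpha gamma * metric gamma beta.

(* d f / d psi_c *)
Definition dpsi (c : 'I_5) (f : state R -> R^o) psi : R :=
  'D_(delta_mx ord0 c) f psi.

(* d f(psi) / d x^delta by the chain rule, at a state and a gradient that
   are independent of each other. *)
Definition dx (f : state R -> R^o) psi (G : gradient R) (delta : 'I_4) : R :=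
  \sum_(c < 5) dpsi c f psi * G c delta.

End Minkowski.

Section Fluid.
Variables (R : realType) (O : set (R^o * R^o)%type) (p : (R^o * R^o)%type -> R^o).
Implicit Types (psi : state R) (G : gradient R).

(* p(theta, psi_4) on the open domain O. *)
Definition p_theta (z : R^o * R^o) : R := 'D_((1 : R^o), (0 : R^o)) p z.
Definition p_psi4 (z : R^o * R^o) : R := 'D_((0 : R^o), (1 : R^o)) p z.

Definition equation_of_state : Prop :=
  [/\ open O,
      (forall z, O z -> 0 < z.1),
      smooth_on O p,
      (forall z, O z -> 0 < p_theta z) &
      (forall z, O z -> 0 < p_psi4 z)].

Definition states : set (state R) :=
  [set psi | future_timelike psi /\ O (theta psi, psi4 psi)].

Definition pressure psi : R := p (theta psi, psi4 psi).
Definition rho psi : R :=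
  theta psi * p_theta (theta psi, psi4 psi) - pressure psi.
Definition density psi : R := p_psi4 (theta psi, psi4 psi) / theta psi.
Definition enthalpy psi : R := (rho psi + pressure psi) / density psi.

Definition T_ideal (a : 'I_5) (beta : 'I_4) psi : R :=
  if unlift i4 a is Some alpha then
    (rho psi + pressure psi) * U_up psi alpha * U_up psi beta
      + pressure psi * metric R alpha beta
  else density psi * U_up psi beta.

Definition DeltaT_L (eta zeta kappa : state R -> R) psi G : tensor R :=
  \matrix_(a < 5, beta < 4) -
   (if unlift i4 a is Some alpha then
      eta psi *
        (\sum_(gamma < 4) \sum_(delta < 4)
           Pi_up psi alpha gamma * Pi_up psi beta delta *
             (dx (fun s => U_low s gamma) psi G delta + dx (fun s => U_low s delta) psi G gamma
              - 2 / 3 * metric R gamma delta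
                * \sum_(sigma < 4) dx (fun s => U_up s sigma) psi G sigma))
      + zeta psi * Pi_up psi alpha beta
        * \sum_(gamma < 4) dx (fun s => U_up s gamma) psi G gamma
    else
      kappa psi / enthalpy psi ^+ 2
        * \sum_(delta < 4) Pi_up psi beta delta * G i4 delta).

(* C^f_a, first index up *)
Definition C_mixed (lam mu nu : state R -> R) psi (f a : 'I_5) : R :=
  match unlift i4 f, unlift i4 a with
  | Some phi, Some alpha =>
      mu psi / theta psi ^+ 2 * U_up psi phi * U_low psi alpha
      + nu psi / theta psi * Pi_mixed psi phi alpha
  | None, None => lam psi
  | _, _ => 0
  end.

(* C_{f a}: Greek first indices are lowered with the metric, f = 4 is
   unaffected. *)
Definition C_low (lam mu nu : state R -> R) psi (f a : 'I_5) : R :=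
  if unlift i4 f is Some phi then
    \sum_(alpha < 4) metric R phi alpha * C_mixed lam mu nu psi (greek alpha) a
  else C_mixed lam mu nu psi i4 a.

Definition gradient_shift (lam mu nu : state R -> R) psi G : tensor R :=
  \matrix_(a < 5, beta < 4)
    \sum_(f < 5) \sum_(b < 5) \sum_(delta < 4) \sum_(c < 5)
      dpsi f (T_ideal a beta) psi * C_low lam mu nu psi f b
      * dpsi c (T_ideal b delta) psi * G c delta.

(* Dissipation tensors live over [states]; their values at other arguments
   are irrelevant to membership. *)
Definition E5_L (eta zeta kappa : state R -> R) :
    set (state R -> gradient R -> tensor R) :=
  [set DT | exists lam mu nu : state R -> R,
     [/\ smooth_on states lam, smooth_on states mu, smooth_on states nu &
       forall psi G, states psi ->
         DT psi G = DeltaT_L eta zeta kappa psi G + gradient_shift lam mu nu psi G]].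

Definition local_equilibrium G : Prop :=
  (forall gamma delta : 'I_4, G (greek gamma) delta = - G (greek delta) gamma) /\
  (forall delta : 'I_4, G i4 delta = 0).

Definition respects_local_equilibria (DT : state R -> gradient R -> tensor R) :
    Prop :=
  forall psi G, states psi -> local_equilibrium G ->
    forall (a : 'I_5) (beta : 'I_4), DT psi G a beta = 0.

End Fluid.

(* Main.v *)
Require Import Defs.
From mathcomp Require Import all_boot all_order all_algebra.
From mathcomp Require Import all_classical all_reals all_analysis.
From mathcomp Require Import ring.

Set Implicit Arguments.
Unset Strict Implicit.
Unset Printing Implicit Defensive.

Import Order.TTheory GRing.Theory Num.Theory.
Import numFieldNormedType.Exports.
Local Open Scope classical_set_scope.
Local Open Scope ring_scope.

(** Local equilibria are invisible to every element of the orbit because each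
    term of the dissipation tensor contracts the antisymmetric block of the
    gradient with something symmetric, or projects it away.

    Let [G] be such a gradient.  As [G i4] vanishes, only derivatives in the
    directions [psi_0, ..., psi_3] count.  In these directions a function of
    the Lorentz invariant [theta] and of [psi_4] has a derivative proportional
    to the vector [psi^gamma]; such functions are called [radial] below, and
    for [theta] itself the factor is [theta^3].

    Gradient shift.  The shift is a linear image of the Eulerian divergences
    [sum_(delta, c) dT^{a delta}/dpsi_c G_{c delta}], so it suffices that they
    vanish.  Conceptually [T^{a delta}] is the
    derivative of [p psi^delta] in [psi_a], and [p psi^delta] is the derivative
    in [psi_delta] of a function of [theta] and [psi_4]; hence
    [dT^{a delta}/dpsi_gamma] is symmetric in [gamma, delta].  Here the symmetry
    is read off a direct computation ([T_ideal_sym]): the thermodynamic factors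
    are radial, and the only terms not visibly symmetric match because
    [rho + p = theta p_theta], where [p_theta theta^3] is the radial factor of
    the pressure.  Contraction with [G] gives 0 ([sum_sym_equilibrium]).

    Landau-Lifshitz part.  The product rule gives
    [dU_gamma/dx^delta = theta G_{gamma delta} + psi_gamma dtheta/dx^delta]:
    the first term cancels in the symmetrized gradient and the second one is
    killed by the projector [Pi], which annihilates [psi] ([Pi_psi_low]).  The
    divergence of [U] vanishes as [dU^sigma/dpsi_gamma] is again symmetric
    ([div_U_eq0]), and the heat flux vanishes with [G i4]. *)

(** * Directional derivatives of scalar functions *)

Section Calculus.
Context {R : realType} {V : normedModType R}.
Implicit Types (f g : V -> R^o) (a v : V).

(** Reduction to one variable: both sides have the same difference quotients.
    It lets one-variable chain rules apply to directional derivatives. *)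
Lemma is_derive_line f a v (l : R^o) :
  is_derive a v f l <-> is_derive (0 : R^o) 1 (fun t : R^o => f (t *: v + a)) l.
Proof.
have quotientE : (fun h : R => h^-1 *: ((f \o shift a) (h *: v) - f a)) =
    (fun h : R => h^-1 *: (((fun t : R^o => f (t *: v + a)) \o shift (0 : R^o))
                       (h *: (1 : R^o)) - f ((0 : R) *: v + a))).
  by apply/funext => h; rewrite /= scale0r add0r addr0 /GRing.scale /= mulr1.
by split => -[df Df]; split; move: df Df;
  rewrite /derivable /derive quotientE.
Qed.

Lemma is_derive_comp1 (g : R -> R) f a v (dg df : R) :
  is_derive (f a) 1 g dg -> is_derive a v f df ->
  is_derive a v (fun x => g (f x) : R^o) (dg * df).
Proof.
move=> Dg /is_derive_line Df; apply/is_derive_line.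
apply: (@is_derive1_comp R g (fun t : R => f (t *: v + a))) => //.
by rewrite scale0r add0r.
Qed.

Lemma is_derive_mul f g a v (df dg : R) :
  is_derive a v f df -> is_derive a v g dg ->
  is_derive a v (fun x => f x * g x : R^o) (f a * dg + g a * df).
Proof. exact: is_deriveM. Qed.

Lemma is_derive_add f g a v (df dg : R) :
  is_derive a v f df -> is_derive a v g dg ->
  is_derive a v (fun x => f x + g x : R^o) (df + dg).
Proof. exact: is_deriveD. Qed.

Lemma is_derive_bigsum n (h : 'I_n -> V -> R^o) a v (dh : 'I_n -> R) :
  (forall i, is_derive a v (h i) (dh i)) ->
  is_derive a v (fun x => \sum_(i < n) h i x : R^o) (\sum_(i < n) dh i).
Proof.
move=> Dh; have := is_derive_sum Dh.
by congr (is_derive _ _ _ _); apply/funext => x; rewrite fct_sumE.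
Qed.

End Calculus.

(** * Derivatives with respect to the Greek state variables *)

Section Kinematics.
Context {R : realType}.
Implicit Types (psi : 'rV[R]_5) (G : 'M[R]_(5, 4)).

Lemma metricC (i j : 'I_4) : metric R i j = metric R j i.
Proof. by rewrite !mxE eq_sym; case: eqP => // ->. Qed.

Lemma sum_greek (F : 'I_5 -> R) :
  \sum_(c < 5) F c = F i4 + \sum_(g < 4) F (greek g).
Proof. by rewrite (bigD1_ord i4). Qed.

Lemma greek_neq4 g : (i4 == greek g) = false.
Proof. by rewrite -val_eqE /= /bump leqNgt ltn_ord add0n; case: g => -[|[|[|[|]]]]. Qed.

Definition greek_dir (g : 'I_4) : 'rV[R]_5 := delta_mx ord0 (greek g).

Lemma is_derive_psi_low psi a g :
  is_derive psi (greek_dir g) (fun s => psi_low s a : R^o) (a == g)%:R.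
Proof.
apply/is_derive_line.
have -> : (fun t : R^o => psi_low (t *: greek_dir g + psi) a : R^o) =
    ((a == g)%:R : R) \*: (id : R^o -> R^o) + cst (psi_low psi a : R^o).
  apply/funext => t; rewrite /psi_low /greek_dir !mxE eqxx /= (inj_eq lift_inj).
  by rewrite mulrC.
apply: is_derive_eq.
by rewrite addr0 /GRing.scale /= mulr1.
Qed.

Lemma is_derive_psi_up psi a g :
  is_derive psi (greek_dir g) (fun s => psi_up s a : R^o) (metric R a g).
Proof.
apply: (@is_derive_eq _ _ _ _ _ _ _ _ (is_derive_bigsum (fun b => is_derive_mul
  (is_derive_cst (metric R a b : R^o) psi (greek_dir g)) (is_derive_psi_low psi b g))));
  rewrite (bigD1 g) //= eqxx mulr1 mulr0 addr0 big1 ?addr0 //.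
by move=> b /negPf ->; rewrite !mulr0 addr0.
Qed.

Lemma is_derive_psi_sq psi g :
  is_derive psi (greek_dir g) (fun s => psi_sq s : R^o) (2 * psi_up psi g).
Proof.
apply: (@is_derive_eq _ _ _ _ _ _ _ _ (is_derive_bigsum (fun a => is_derive_mul
  (is_derive_psi_up psi a g) (is_derive_psi_low psi a g))));
  rewrite big_split /= (bigD1 g) //= eqxx mulr1.
rewrite big1 ?addr0 => [|b /negPf ->]; last by rewrite mulr0.
rewrite mulr_natl mulr2n; congr (_ + _).
by apply: eq_bigr => a _; rewrite mulrC metricC.
Qed.

(** The pattern shared by all functions of the invariants [psi_sq] and [psi4];
    [psi_up] appears because the gradient of [psi_sq] is [2 psi^gamma]. *)
Definition radial psi (f : 'rV[R]_5 -> R^o) (K : R) : Prop :=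
  forall g, is_derive psi (greek_dir g) f (K * psi_up psi g).

Lemma radialM psi (f1 f2 : 'rV[R]_5 -> R^o) (K1 K2 : R) :
  radial psi f1 K1 -> radial psi f2 K2 ->
  radial psi (fun s => f1 s * f2 s) (f1 psi * K2 + f2 psi * K1).
Proof.
move=> D1 D2 g; apply: (@is_derive_eq _ _ _ _ _ _ _ _ (is_derive_mul (D1 g) (D2 g))).
by ring.
Qed.

Lemma radial_comp psi (h : R -> R) (f : 'rV[R]_5 -> R^o) (dh K : R) :
  is_derive (f psi : R) 1 h dh -> radial psi f K ->
  radial psi (fun s => h (f s)) (dh * K).
Proof. by move=> Dh Df g; rewrite -mulrA; apply: is_derive_comp1. Qed.

Lemma is_derive_inv (x : R) : x != 0 ->
  is_derive x 1 (fun y : R => y^-1) (- x ^- 2).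
Proof.
move=> x0; have DV := @is_deriveV R id x 1 1 x0 (is_derive_id _ _).
by apply: (@is_derive_eq _ _ _ _ _ _ _ _ DV); rewrite /GRing.scale /= mulr1.
Qed.

Section AtState.
Variable psi : 'rV[R]_5.
Hypothesis psiT : future_timelike psi.

Lemma theta_gt0 : 0 < theta psi.
Proof. by rewrite invr_gt0 sqrtr_gt0 oppr_gt0; case: psiT. Qed.

(** The normalization [U^alpha U_alpha = -1]. *)
Lemma theta_sq : theta psi ^+ 2 * psi_sq psi = -1.
Proof.
have [s0 _] := psiT.
rewrite /theta exprVn sqr_sqrtr ?oppr_ge0 ?ltW //.
by rewrite invrN mulNr mulVf // lt_eqF.
Qed.

(** By the chain rule: [theta] is the power -1/2 of [- psi_sq], whence the factor
    [- theta^2 * (theta / 2) * (-2)]. *)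
Lemma radial_theta : radial psi (fun s => theta s : R^o) (theta psi ^+ 3).
Proof.
have [s0 _] := psiT.
have q0 : 0 < Num.sqrt (- psi_sq psi) by rewrite sqrtr_gt0 oppr_gt0.
have sqD : radial psi (fun s => - psi_sq s) (-2).
  move=> g; have DN := is_deriveN (is_derive_psi_sq psi g).
  by apply: (@is_derive_eq _ _ _ _ _ _ _ _ DN); rewrite mulNr.
have p0 : 0 < - psi_sq psi by rewrite oppr_gt0.
have := radial_comp (@is_derive_inv _ (lt0r_neq0 q0))
  (radial_comp (is_derive1_sqrt p0) sqD).
by congr radial; rewrite /theta; field; rewrite lt0r_neq0.
Qed.

(** Moving along a Greek direction keeps [psi4] fixed, so only the slice
    [u |-> F (u, psi4 psi)] matters and the chain rule is one-dimensional. *)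
Lemma radial_thermo (F : R^o * R^o -> R^o) :
  derivable F (theta psi, psi4 psi) ((1 : R^o), (0 : R^o)) ->
  radial psi (fun s => F (theta s, psi4 s))
    ('D_((1 : R^o), (0 : R^o)) F (theta psi, psi4 psi) * theta psi ^+ 3).
Proof.
move=> /derivableP/is_derive_line DF g.
have psi4_const (t : R) : psi4 (t *: greek_dir g + psi) = psi4 psi.
  by rewrite /psi4 /greek_dir !mxE greek_neq4 andbF mulr0 add0r.
have Dslice : is_derive (theta psi) 1 (fun u : R => F (u, psi4 psi))
    ('D_((1 : R^o), (0 : R^o)) F (theta psi, psi4 psi)).
  apply/(@is_derive_line R R^o); move: DF; congr (is_derive _ _ _ _).
  apply/funext => t; congr F; congr pair => /=.
  by rewrite scaler0 add0r.
have := is_derive_comp1 Dslice (radial_theta g).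
move=> /is_derive_line D; apply/is_derive_line.
rewrite -mulrA; move: D; congr (is_derive _ _ _ _).
by apply/funext => t /=; rewrite psi4_const.
Qed.

(** [Pi] projects onto the orthogonal complement of [U], hence kills [psi]. *)
Lemma Pi_psi_low a : \sum_(g < 4) Pi_up psi a g * psi_low psi g = 0.
Proof.
transitivity (psi_up psi a * (1 + theta psi ^+ 2 * psi_sq psi)); last first.
  by rewrite theta_sq subrr mulr0.
rewrite mulrDr mulr1 /psi_sq !mulr_sumr -big_split; apply: eq_bigr => g _ /=.
by rewrite /Pi_up /U_up; ring.
Qed.

End AtState.

(** * Contraction with the gradient of a local equilibrium *)

Section Equilibrium.
Variable G : 'M[R]_(5, 4).
Hypothesis Geq : local_equilibrium G.

Lemma sum_sym_equilibrium (S : 'I_4 -> 'I_4 -> R) :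
  (forall g d, S g d = S d g) ->
  \sum_(d < 4) \sum_(g < 4) S g d * G (greek g) d = 0.
Proof.
move=> SC; set X := (LHS).
suff /eqP : X = - X by rewrite -addr_eq0 -mulr2n mulrn_eq0 => /eqP.
rewrite {1}/X exchange_big /= /X -sumrN; apply: eq_bigr => d _.
rewrite -sumrN; apply: eq_bigr => g _.
by rewrite SC (proj1 Geq) mulrN.
Qed.

Lemma dx_equilibrium (f : 'rV[R]_5 -> R^o) psi d (df : 'I_4 -> R) :
  (forall g, is_derive psi (greek_dir g) f (df g)) ->
  dx f psi G d = \sum_(g < 4) df g * G (greek g) d.
Proof.
move=> Df; rewrite /dx sum_greek (proj2 Geq) mulr0 add0r.
by apply: eq_bigr => g _; rewrite /dpsi (@derive_val _ _ _ _ _ _ _ (Df g)).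
Qed.

End Equilibrium.
End Kinematics.

(** * Vanishing of the two parts of the dissipation tensor *)

Section Equilibria.
Context {R : realType} (O : set (R^o * R^o)) (p : R^o * R^o -> R^o).
Hypothesis Hp : equation_of_state O p.
Variables (psi : 'rV[R]_5) (G : 'M[R]_(5, 4)).
Hypotheses (psiO : states O psi) (Geq : local_equilibrium G).

Let psiT : future_timelike psi := proj1 psiO.

(** The temperature gradient in a local equilibrium, by [radial_theta]. *)
Definition dtheta (d : 'I_4) : R :=
  theta psi ^+ 3 * \sum_(g < 4) psi_up psi g * G (greek g) d.

Lemma dx_U_low a d :
  dx (fun s => U_low s a : R^o) psi G d =
  theta psi * G (greek a) d + psi_low psi a * dtheta d.
Proof.
rewrite (dx_equilibrium Geq _ (fun g => is_derive_mul
  (radial_theta psiT g) (is_derive_psi_low psi a g))).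
under eq_bigr do rewrite mulrDl.
rewrite big_split /=; congr (_ + _).
  rewrite (bigD1 a) //= eqxx mulr1 big1 ?addr0 // => g /negPf ga.
  by rewrite eq_sym ga mulr0 mul0r.
rewrite /dtheta !mulr_sumr; apply: eq_bigr => g _; ring.
Qed.

(** The symmetry of this expression in [a, g] is why the divergence of [U]
    vanishes in a local equilibrium and why the particle current satisfies
    [T_ideal_sym]. *)
Lemma is_derive_U_up a g :
  is_derive psi (greek_dir g) (fun s => U_up s a : R^o)
    (theta psi * metric R a g + theta psi ^+ 3 * psi_up psi g * psi_up psi a).
Proof.
have DU := is_derive_mul (radial_theta psiT g) (is_derive_psi_up psi a g).
by apply: (@is_derive_eq _ _ _ _ _ _ _ _ DU); ring.
Qed.

Lemma div_U_eq0 : \sum_(a < 4) dx (fun s => U_up s a : R^o) psi G a = 0.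
Proof.
under eq_bigr do rewrite (dx_equilibrium Geq _ (is_derive_U_up _)).
apply: (sum_sym_equilibrium Geq (S :=
  fun g d => theta psi * metric R d g + theta psi ^+ 3 * psi_up psi g * psi_up psi d)).
by move=> g d; rewrite metricC; ring.
Qed.

Lemma DeltaT_L_equilibrium (eta zeta kappa : 'rV[R]_5 -> R) a b :
  DeltaT_L p eta zeta kappa psi G a b = 0.
Proof.
rewrite mxE; apply/eqP; rewrite oppr_eq0; apply/eqP.
case: (unlift i4 a) => [al|]; last first.
  by rewrite big1 ?mulr0 // => d _; rewrite (proj2 Geq) mulr0.
rewrite div_U_eq0 mulr0 addr0 [X in _ * X](_ : _ = 0) ?mulr0 //.
(* The traceless symmetric gradient is [psi_g dtheta_d + psi_d dtheta_g], so the
   double projection splits into two products of simple sums. *)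
transitivity ((\sum_(g < 4) Pi_up psi al g * psi_low psi g) *
              (\sum_(d < 4) Pi_up psi b d * dtheta d) +
              (\sum_(g < 4) Pi_up psi al g * dtheta g) *
              (\sum_(d < 4) Pi_up psi b d * psi_low psi d)); last first.
  by rewrite !Pi_psi_low // mul0r mulr0 addr0.
rewrite !mulr_suml -big_split; apply: eq_bigr => g _ /=.
rewrite !mulr_sumr -big_split; apply: eq_bigr => d _ /=.
by rewrite !dx_U_low (proj1 Geq g d); ring.
Qed.

Let derivable_p : derivable p (theta psi, psi4 psi) ((1 : R^o), (0 : R^o)).
Proof.
have [_ _ /(_ 1%N) [Dp _] _ _] := Hp.
by apply: diff_derivable; apply: Dp; case: psiO.
Qed.

Let derivable_dp v :
  derivable (fun z => 'D_v p z : R^o) (theta psi, psi4 psi) ((1 : R^o), (0 : R^o)).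
Proof.
have [_ _ /(_ 2%N) [_ /(_ v) [Dp _]] _ _] := Hp.
by apply: diff_derivable; apply: Dp; case: psiO.
Qed.

Lemma radial_pressure : radial psi (fun s => pressure p s : R^o)
  (p_theta p (theta psi, psi4 psi) * theta psi ^+ 3).
Proof. exact: radial_thermo. Qed.

(** The factor involves second derivatives of the pressure.  It can be left
    existential because it only multiplies [psi^gamma U^alpha U^delta], which is
    already symmetric in [gamma, delta]. *)
Lemma radial_rhoDp :
  exists K, radial psi (fun s => rho p s + pressure p s : R^o) K.
Proof.
rewrite (_ : (fun s => _) = (fun s => theta s * p_theta p (theta s, psi4 s) : R^o)).
  have D := radialM (radial_theta psiT)
    (radial_thermo psiT (@derivable_dp ((1 : R^o), (0 : R^o)))).
  by eexists; exact: D.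
by apply/funext => s; rewrite /rho subrK.
Qed.

Lemma radial_density : exists K, radial psi (fun s => density p s : R^o) K.
Proof.
have theta0 : theta psi != 0 by rewrite lt0r_neq0 // theta_gt0.
have D := radialM (radial_thermo psiT (@derivable_dp ((0 : R^o), (1 : R^o))))
  (radial_comp (is_derive_inv theta0) (radial_theta psiT)).
by eexists; exact: D.
Qed.

(** The derivative [dT^{a d}/dpsi_g] is symmetric in [g, d]. For Greek [a] the
    symmetry pairs the term [(rho + p) theta U^d g^{a g}] with the pressure term
    [p_theta theta^3 psi^g g^{a d}]: exchanging [g] and [d] turns one into the other
    because [rho + p = theta p_theta]. *)
Lemma T_ideal_sym a : exists S : 'I_4 -> 'I_4 -> R,
  (forall g d, S g d = S d g) /\
  forall d g, is_derive psi (greek_dir g) (fun s => T_ideal p a d s : R^o) (S g d).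
Proof.
rewrite /T_ideal; case: (unlift i4 a) => [al|].
- have [K DK] := radial_rhoDp.
  (* The product rule determines the witness, so it is proved first. *)
  eexists (fun g d => _); split; last first.
    move=> d g; apply: is_derive_add.
      apply: is_derive_mul (is_derive_U_up d g).
      apply: is_derive_mul (is_derive_U_up al g); exact: DK.
    apply: is_derive_mul; exact: radial_pressure.
  move=> g d /=; rewrite (metricC d g) /U_up /rho; ring.
- have [K DK] := radial_density.
  eexists (fun g d => _); split; last first.
    move=> d g; apply: is_derive_mul (is_derive_U_up d g); exact: DK.
  by move=> g d /=; rewrite (metricC d g) /U_up; ring.
Qed.

Lemma div_T_ideal_eq0 a :
  \sum_(d < 4) \sum_(c < 5) dpsi c (fun s => T_ideal p a d s : R^o) psi * G c d = 0.
Proof.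
have [S [SC DS]] := T_ideal_sym a.
transitivity (\sum_(d < 4) dx (fun s => T_ideal p a d s : R^o) psi G d) => //.
under eq_bigr do rewrite (dx_equilibrium Geq _ (DS _)).
exact: sum_sym_equilibrium.
Qed.

(** The factor [dT/dpsi_f C_fb] of the shift does not involve the gradient, so it
    comes out of the sum over [delta] and [c]. *)
Lemma gradient_shift_equilibrium lam mu nu a b :
  gradient_shift p lam mu nu psi G a b = 0.
Proof.
rewrite mxE big1 // => f _; rewrite big1 // => c _.
under eq_bigr do (under eq_bigr do rewrite -mulrA; rewrite -mulr_sumr).
by rewrite -mulr_sumr div_T_ideal_eq0 mulr0.
Qed.

End Equilibria.

Theorem theorem3 (R : realType) (O : set (R^o * R^o)%type)
    (p : (R^o * R^o)%type -> R^o) (eta zeta kappa : 'rV[R]_5 -> R)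
    (Hp : equation_of_state O p)
    (eta_smooth : smooth_on (states O) eta)
    (zeta_smooth : smooth_on (states O) zeta)
    (kappa_smooth : smooth_on (states O) kappa)
    (eta_gt0 : forall psi, states O psi -> 0 < eta psi)
    (zeta_gt0 : forall psi, states O psi -> 0 < zeta psi)
    (kappa_gt0 : forall psi, states O psi -> 0 < kappa psi)
    (DT : 'rV[R]_5 -> 'M[R]_(5, 4) -> 'M[R]_(5, 4)) :
  E5_L O p eta zeta kappa DT -> respects_local_equilibria O DT.
Proof.
move=> [lam [mu [nu [_ _ _ DTE]]]] psi G psiO Geq a b.
rewrite DTE // mxE (DeltaT_L_equilibrium (O := O)) //.
by rewrite (gradient_shift_equilibrium (O := O)) // addr0.
Qed.
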